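(* Fix $u\in[0,1)$, $\lambda\vdash n$ and $\sigma\in S_r$ with $r\le n-1$. Let $\bar j$ be the index such that $(F^\lambda_{ct})^*(u)=\frac{y_{\bar j}}{\sqrt n}$, and define $$\bar u:=\frac{\dim\lambda}{\dim\mu_{\bar j}}\Big(u-\sum_{j<\bar j}\frac{\dim\mu_j}{\dim\lambda}\Big).$$ Then $\bar u<1$ and $$PT^\lambda_u(\sigma)=\sum_{j<\bar j}\frac{\dim\mu_j}{\dim\lambda}\,\hat\chi^{\mu_j}(\sigma)+\frac{\dim\mu_{\bar j}}{\dim\lambda}\,PT^{\mu_{\bar j}}_{\bar u}(\sigma).$$
   Context: Partitions $\lambda\vdash n$ are identified with Young diagrams in English notation (row 1 on top); the box in row $b$ and column $a$ has content $a-b$. $\mathrm{SYT}(\lambda)$ is the set of standard Young tableaux of shape $\lambda$ and $\dim\lambda=|\mathrm{SYT}(\lambda)|$. For $T\in\mathrm{SYT}(\lambda)$ let $c_k(T)$ be the content of the box containing $k$, and $d_k(T):=c_{k+1}(T)-c_k(T)$. If $k,k+1$ lie in different rows and different columns of $T$, $(k,k+1)T$ is the standard tableau obtained by exchanging them. The representation $\pi^\lambda$ of $S_n$ has matrices with rows and columns indexed by $\mathrm{SYT}(\lambda)$, determined by: $\pi^\lambda((k,k+1))_{T,S}=1/d_k(T)$ if $S=T$; $=\sqrt{1-1/d_k(T)^2}$ if $S=(k,k+1)T$; $=0$ otherwise; extended multiplicatively to $S_n$ (permutations composed right to left). It is irreducible with character $\chi^\lambda$, and $\hat\chi^\lambda=\chi^\lambda/\dim\lambda$.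 For $r\le n$, $S_r\subset S_n$ is the subgroup fixing $r+1,\ldots,n$. Last letter order on $\mathrm{SYT}(\lambda)$: for $T\ne S$, let $k$ be the largest entry lying in different rows in $T$ and $S$; then $T<S$ iff $k$ lies in a lower row (larger row index) in $T$ than in $S$. Write $T_1<T_2<\dots$ for the tableaux in this order and $\pi^\lambda(\sigma)_{i,j}=\pi^\lambda(\sigma)_{T_i,T_j}$. Partial trace: $PT^\lambda_u(\sigma):=\sum_{i\le u\dim\lambda}\pi^\lambda(\sigma)_{i,i}/\dim\lambda$. $y_1<\dots<y_d$ are the contents of the removable boxes (corners) of $\lambda$; $\mu_j\vdash n-1$ is obtained from $\lambda$ by removing the corner of content $y_j$. $F^\lambda_{ct}(v)=\sum_{y_j\le v\sqrt n}\frac{\dim\mu_j}{\dim\lambda}$ for $v\in\mathbb R$, and $(F^\lambda_{ct})^*(u):=\sup\{z\in\mathbb R:F^\lambda_{ct}(z)\le u\}$; for $u\in[0,1)$ this supremum is of the form $y_{\bar j}/\sqrt n$. *)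

(* Defs.v *)
From mathcomp Require Import all_boot all_order all_algebra all_fingroup.
From mathcomp Require Import zify ring.
From mathcomp Require Import boolp classical_sets reals.

Set Implicit Arguments.
Unset Strict Implicit.
Unset Printing Implicit Defensive.

Import Order.TTheory GRing.Theory Num.Theory.

Local Open Scope ring_scope.

(* Rows, columns, entries of tableaux and points of 'S_n are numbered from 0. *)

Definition is_intpart (n : nat) (s : seq nat) : bool :=
  [&& sorted geq s, 0%N \notin s & sumn s == n].

Record intpart (n : nat) := IntPart {
  parts :> seq nat;
  partsP : is_intpart n parts
}.

(* Boxes are pairs (row, column). *)
Definition in_diagram (s : seq nat) (b : nat * nat) : bool :=
  (b.2 < nth 0 s b.1)%N.

Definition content (b : nat * nat) : int := b.2%:Z - b.1%:Z.

Section Tableaux.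

Variables (n : nat) (lam : intpart n).

(* A filling sends each entry to its box; since the diagram has n boxes, all  *)
(* of whose coordinates are smaller than n, an injective filling of it is     *)
(* bijective.                                                                 *)
Definition filling := {ffun 'I_n -> 'I_n * 'I_n}.

Definition box (f : filling) (k : 'I_n) : nat * nat :=
  (val (f k).1, val (f k).2).

Definition row_of (f : filling) (k : 'I_n) : nat := (box f k).1.
Definition col_of (f : filling) (k : 'I_n) : nat := (box f k).2.
Definition cont_of (f : filling) (k : 'I_n) : int := content (box f k).

Definition is_syt (f : filling) : bool :=
  [&& injectiveb f,
      [forall k, in_diagram lam (box f k)],
      [forall k, forall l,
         (row_of f k == row_of f l) && (col_of f k < col_of f l)%N
           ==> (k < l)%N]
    & [forall k, forall l,
         (col_of f k == col_of f l) && (row_of f k < row_of f l)%N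
           ==> (k < l)%N]].

Definition syt : finType := {f : filling | is_syt f}.

Definition dim_part : nat := #|syt|.

Definition swap (k l : 'I_n) (f : filling) : filling :=
  [ffun i => f (tperm k l i)].

(* Last letter order. *)
Definition ll_lt (T S : syt) : bool :=
  [exists k : 'I_n,
     (row_of (val S) k < row_of (val T) k)%N &&
     [forall l : 'I_n,
        (k < l)%N ==> (row_of (val T) l == row_of (val S) l)]].

Definition ll_le (T S : syt) : bool := (T == S) || ll_lt T S.

Definition tab (i : 'I_(dim_part)) : syt :=
  tnth [tuple of sort ll_le (enum_tuple syt)] i.

End Tableaux.

Section YoungOrthogonal.

Variables (R : realType) (n : nat) (lam : intpart n).

(* For consecutive entries k, l. As tab j is standard, it can only be the     *)
(* exchange of k and l in tab i if these lie in different rows and columns.   *)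
Definition young_gen (k l : 'I_n) : 'M[R]_(dim_part lam) :=
  \matrix_(i, j)
    let T := val (tab i) in
    let d : R := (cont_of T l - cont_of T k)%:~R in
    if j == i then d^-1
    else if val (tab j) == swap k l T then Num.sqrt (1 - (d ^+ 2)^-1)
    else 0.

(* (t * s)%g is the composite s o t: products of permutations are read from   *)
(* left to right.                                                             *)
Definition is_young_rep (p : 'S_n -> 'M[R]_(dim_part lam)) : Prop :=
  [/\ p 1%g = 1%:M,
      forall s t : 'S_n, p (t * s)%g = p s *m p t
    & forall k l : 'I_n, l = k.+1 :> nat -> p (tperm k l) = young_gen k l].

End YoungOrthogonal.

Lemma adjacent_ind (n : nat) (P : 'S_n -> Prop) :
    P 1%g -> (forall s t : 'S_n, P s -> P t -> P (s * t)%g) ->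
    (forall k l : 'I_n, l = k.+1 :> nat -> P (tperm k l)) ->
  forall s, P s.
Proof.
move=> P1 PM Padj.
have Plt d : forall i j : 'I_n, j = (i + d.+1)%N :> nat -> P (tperm i j).
  elim: d => [|d IHd] i j ej; first by apply: Padj; lia.
  have ltk : (i + d.+1 < n)%N by have := ltn_ord j; lia.
  pose k := Ordinal ltk.
  have Pk : P (tperm k j) by apply: Padj; rewrite /= ej addnS.
  have -> : tperm i j = (tperm k j * (tperm i k * tperm k j))%g.
    have := tpermJ i k (tperm k j); rewrite conjgE tpermV tpermL => ->.
    by rewrite tpermD //; apply/eqP => /(congr1 val) /=; lia.
  by apply: (PM) => //; apply: (PM) => //; apply: IHd.
have Pt i j : P (tperm i j).
  case: (ltngtP i j) => [lt|lt|/val_inj->]; last by rewrite tperm1.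
    by apply: (Plt (j - i).-1); lia.
  by rewrite tpermC; apply: (Plt (i - j).-1); lia.
move=> s; have [ts -> _] := prod_tpermP s.
by elim: ts => [|x ts IH]; rewrite ?big_nil ?big_cons //; apply: PM.
Qed.

Lemma lift_perm_tperm (n : nat) (j : 'I_n.+1) (a b : 'I_n) :
  lift_perm j j (tperm a b) = tperm (lift j a) (lift j b).
Proof.
apply/permP => i; case: (unliftP j i) => [k|] ->.
  rewrite lift_perm_lift; case: (tpermP a b k) => [->|->|ka kb].
  - by rewrite tpermL.
  - by rewrite tpermR.
  - by rewrite tpermD // (inj_eq lift_inj) eq_sym; apply/eqP.
by rewrite lift_perm_id tpermD // eq_sym neq_lift.
Qed.

Lemma lift_perm_adj (n : nat) (j k l : 'I_n.+1) (s : 'S_n) :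
    (l == k.+1 :> nat) || (k == l.+1 :> nat) ->
  (lift_perm j k s * tperm k l)%g = lift_perm j l s.
Proof.
move=> kl; apply/permP => i; rewrite permM.
case: (unliftP j i) => [a|] ->; last by rewrite !lift_perm_id tpermL.
rewrite !lift_perm_lift; case: tpermP => [/esym/eqP|e|ne1 ne2].
- by rewrite (negPf (neq_lift _ _)).
- apply/val_inj; rewrite /= /bump.
  by move/(congr1 val): e; rewrite /= /bump; lia.
- apply/val_inj; rewrite /= /bump.
  have /eqP : val (lift k (s a)) <> l by move/val_inj.
  by rewrite /= /bump; lia.
Qed.

Lemma lift_permP (n : nat) (i : 'I_n.+1) (s : 'S_n.+1) :
  exists t, s = lift_perm i (s i) t.
Proof.
have ex (a : 'I_n) : {b : 'I_n | s (lift i a) = lift (s i) b}.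
  case: (unliftP (s i) (s (lift i a))) => [b e|/perm_inj/eqP]; first by exists b.
  by rewrite eq_sym (negPf (neq_lift _ _)).
have injf : injective (fun a => sval (ex a)).
  move=> a b; case: (ex a) => c ec; case: (ex b) => d ed /= ecd.
  by apply: (@lift_inj _ i); apply: (@perm_inj _ s); rewrite ec ed ecd.
exists (perm injf); apply/permP => a; case: (unliftP i a) => [b|] ->.
  by rewrite lift_perm_lift permE; case: (ex b).
by rewrite lift_perm_id.
Qed.

Lemma lift_perm_inj (n : nat) (i j : 'I_n.+1) : injective (@lift_perm n i j).
Proof.
move=> s t st; apply/permP => a; apply: (@lift_inj _ j).
by rewrite -(lift_perm_lift i) st lift_perm_lift.
Qed.

Lemma coxeter_ext (M : pzRingType) (A : nat -> M) (n : nat) :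
    (forall k, (k.+1 < n)%N -> A k * A k = 1) ->
    (forall k, (k.+2 < n)%N -> A k * A k.+1 * A k = A k.+1 * A k * A k.+1) ->
    (forall k l, (k.+1 < l)%N -> (l.+1 < n)%N -> A k * A l = A l * A k) ->
  exists p : 'S_n -> M,
    [/\ p 1%g = 1, forall s t : 'S_n, p (s * t)%g = p s * p t
      & forall k l : 'I_n, l = k.+1 :> nat -> p (tperm k l) = A k].
Proof.
elim: n => [|m IHm] invA braidA commA.
  by exists (fun _ => 1); split => // [? ?|[]//]; rewrite mulr1.
case: IHm => [k hk|k hk|k l hk hl|p [p1 pM pA]].
- by apply: invA; lia.
- by apply: braidA; lia.
- by apply: commA; lia.
have [C Cm CS] : exists2 C : nat -> M, C m = 1
    & forall j, (j < m)%N -> C j = C j.+1 * A j.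
  pose D := fix D d := if d is d'.+1 then D d' * A (m - d)%N else 1.
  exists (fun j => D (m - j)%N) => [|j jm]; first by rewrite subnn.
  by rewrite -(subnSK jm) /=; congr (_ * A _); lia.
have L2 j : (j < m)%N -> C j * A j = C j.+1.
  by move=> jm; rewrite (CS j) // -mulrA invA ?mulr1.
have L3 j i : (i.+1 < j)%N -> (j <= m)%N -> C j * A i = A i * C j.
  move=> ij jm; have -> : j = (m - (m - j))%N by lia.
  have : (m - j <= m - i.+2)%N by lia.
  elim: (m - j)%N => [|d IHd] hd; first by rewrite subn0 Cm mul1r mulr1.
  rewrite (CS (m - d.+1)%N); last lia.
  have -> : (m - d.+1).+1 = (m - d)%N by lia.
  rewrite -mulrA -(commA i); [|lia|lia].
  by rewrite !mulrA IHd //; lia.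
have L4 j i : (j < i)%N -> (i < m)%N -> C j * A i = A i.-1 * C j.
  move=> ji im; have -> : j = (i.-1 - (i.-1 - j))%N by lia.
  have : (i.-1 - j <= i.-1)%N by lia.
  elim: (i.-1 - j)%N => [|d IHd] hd.
    case: i ji im hd => // i ji im _; rewrite subn0 /=.
    rewrite (CS i) ?(CS i.+1) //; last lia.
    rewrite -!mulrA [A i.+1 * _]mulrA -braidA //.
    by rewrite !mulrA L3 //; lia.
  rewrite (CS (i.-1 - d.+1)%N); last lia.
  have -> : (i.-1 - d.+1).+1 = (i.-1 - d)%N by lia.
  rewrite -mulrA commA; [|lia|lia].
  by rewrite mulrA IHd ?mulrA //; lia.
pose tau (s : 'S_m.+1) :=
  odflt 1%g [pick t | s == lift_perm ord_max (s ord_max) t].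
pose q (s : 'S_m.+1) := p (tau s) * C (s ord_max).
have qE j t : q (lift_perm ord_max j t) = p t * C j.
  rewrite /q /tau; case: pickP => /= [t' /eqP|/(_ t)]; rewrite lift_perm_id.
    by move/lift_perm_inj ->.
  by rewrite eqxx.
have q1 : q 1%g = 1.
  by rewrite -(lift_perm1 ord_max) qE p1 mul1r Cm.
have qs s (k l : 'I_m.+1) : l = k.+1 :> nat -> q (s * tperm k l)%g = q s * A k.
  move=> ekl; have [t ->] := lift_permP ord_max s; move: (s _) => j.
  rewrite qE -mulrA.
  have lm := ltn_ord l; have jm := ltn_ord j.
  case: (unliftP j k) => [k' ek|ek]; last first.
    rewrite -ek lift_perm_adj ?ekl ?eqxx // qE L2; last lia.
    by rewrite ekl.
  case: (unliftP j l) => [l' el|el]; last first.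
    rewrite -el tpermC lift_perm_adj ?ekl ?eqxx ?orbT //.
    by rewrite qE (CS k) //; lia.
  move: (k' : 'I_m) (l' : 'I_m) ek el => {}k' {}l' ek el.
  rewrite ek el -lift_perm_tperm lift_permM qE -[in RHS]ek.
  move/(congr1 val): ek; move/(congr1 val): el; rewrite /= /bump => el ek.
  have elk : l' = k'.+1 :> nat.
    by move: ek el; case: (leqP j k'); case: (leqP j l') => /=; lia.
  rewrite pM (pA _ _ elk) -mulrA; congr (_ * _).
  case: (leqP j k') ek => /= jk ek; first by rewrite L4 ?ek //; lia.
  have lj : (l' < j)%N by rewrite ltnNge; apply/negP => jl; move: el; rewrite jl; lia.
  have -> : k = k' :> nat by lia.
  by rewrite L3 // -?elk // -ltnS.
exists q; split=> // [s t|k l ekl]; last first.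
  by rewrite -[tperm k l]mul1g qs // q1 mul1r.
move: t s; apply: adjacent_ind => [s|t u IHt IHu s|k l ekl s].
- by rewrite mulg1 q1 mulr1.
- by rewrite mulgA !IHu IHt mulrA.
- by rewrite qs // -[tperm k l]mul1g qs // q1 mul1r.
Qed.

Section StandardFillings.
Variables (n : nat) (lam : intpart n).

Lemma nth_parts_anti i j : (i <= j)%N -> (nth 0 lam j <= nth 0 lam i)%N.
Proof.
have /and3P[s_sorted _ _] := partsP lam => ij.
have [jlt|jge] := ltnP j (size lam); last by rewrite nth_default.
have geq_tr : transitive geq by move=> x y z /= yx zy; apply: leq_trans yx.
have geq_refl : reflexive geq by move=> x /=.
by apply: (sorted_leq_nth geq_tr geq_refl) => //; rewrite inE //; lia.
Qed.

Lemma size_parts_le : (size lam <= n)%N.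
Proof.
have /and3P[_ s0 /eqP sn] := partsP lam; rewrite -[leqRHS]sn.
elim: (parts lam) s0 {sn} => //= x s IHs; rewrite inE negb_or => /andP[x0 /IHs].
by lia.
Qed.

Lemma in_diagram_lt b : in_diagram lam b -> (b.1 < n)%N && (b.2 < n)%N.
Proof.
rewrite /in_diagram => h; have sz := size_parts_le.
have /and3P[_ _ /eqP sn] := partsP lam.
have b1 : (b.1 < size lam)%N.
  by rewrite ltnNge; apply/negP => hs; rewrite nth_default in h.
rewrite (leq_trans b1 sz) /= (leq_trans h) // -[in leqRHS]sn.
by rewrite sumnE (big_nth 0%N) big_mkord (bigD1 (Ordinal b1)) //= leq_addr.
Qed.

Lemma card_diagram :
  #|[set c : 'I_n * 'I_n | in_diagram lam (val c.1, val c.2)]| = n.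
Proof.
rewrite -sum1_card big_mkcond /=.
under eq_bigr do rewrite inE.
rewrite -(pair_bigA _ (fun a b : 'I_n =>
   if in_diagram lam (val a, val b) then 1%N else 0%N)) /=.
have /and3P[_ _ /eqP sn] := partsP lam; have sz := size_parts_le.
transitivity (\sum_(i < n) nth 0%N lam i)%N; last first.
  rewrite -[RHS]sn sumnE (big_nth 0%N).
  rewrite -(big_mkord xpredT (fun i => nth 0%N lam i)).
  rewrite (big_cat_nat (leq0n (size lam)) sz) /=.
  rewrite [X in (_ + X)%N]big1_seq ?addn0 // => i /andP[_].
  by rewrite mem_index_iota => /andP[? _]; rewrite nth_default.
apply: eq_bigr => i _; rewrite -big_mkcond /= /in_diagram /=.
have le : (nth 0%N lam i <= n)%N.
  case e : (nth 0%N lam i) => [//|a].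
  have : in_diagram lam (val i, a) by rewrite /in_diagram /= e.
  by move/in_diagram_lt => /= /andP[].
by rewrite (big_ord_narrow_cond (P := xpredT) le) /= sum1_card card_ord.
Qed.

Section Standard.
Variable F : filling n.
Hypothesis stdF : is_syt lam F.

Let F_inj : injective F. Proof. by case/and4P: stdF => /injectiveP. Qed.

Let F_in k : in_diagram lam (box F k).
Proof. by case/and4P: stdF => _ /forallP. Qed.

Let F_row k l : row_of F k = row_of F l -> (col_of F k < col_of F l)%N ->
  (k < l)%N.
Proof.
case/and4P: stdF => _ _ /forallP/(_ k)/forallP/(_ l)/implyP h _ e1 e2.
by apply: h; rewrite e1 eqxx.
Qed.

Let F_col k l : col_of F k = col_of F l -> (row_of F k < row_of F l)%N ->
  (k < l)%N.
Proof.
case/and4P: stdF => _ _ _ /forallP/(_ k)/forallP/(_ l)/implyP h e1 e2.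
by apply: h; rewrite e1 eqxx.
Qed.

Lemma syt_surj b : in_diagram lam b -> exists k, box F k = b.
Proof.
move=> hb; have /andP[b1 b2] := in_diagram_lt hb.
have : (Ordinal b1, Ordinal b2) \in [set F k | k : 'I_n].
  suff -> : [set F k | k : 'I_n] =
     [set c : 'I_n * 'I_n | in_diagram lam (val c.1, val c.2)].
    by rewrite inE /=; case: b hb {b1 b2}.
  apply/eqP; rewrite eqEcard card_diagram card_imset // card_ord leqnn andbT.
  by apply/fintype.subsetP => c /imsetP[k _ ->]; rewrite inE; apply: F_in.
by case/imsetP => k _ e; exists k; rewrite /box -e /=; case: b hb {b1 b2 e}.
Qed.

Lemma syt_rc_inj k l :
  row_of F k = row_of F l -> col_of F k = col_of F l -> k = l.
Proof.
rewrite /row_of /col_of /box /= => e1 e2; apply: F_inj.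
case: (F k) (F l) e1 e2 => [a b] [c d] /= e1 e2.
by congr pair; apply/val_inj.
Qed.

Lemma syt_diag_row k l : cont_of F k = cont_of F l ->
  (row_of F k < row_of F l)%N -> (k.+2 < l)%N.
Proof.
rewrite /cont_of /content -/(row_of F k) -/(row_of F l).
rewrite -/(col_of F k) -/(col_of F l) => e rlt.
have clt : (col_of F k < col_of F l)%N by lia.
have := F_in l; rewrite /in_diagram -/(row_of F l) -/(col_of F l) => inl.
have [|m em] := @syt_surj (row_of F k, col_of F l).
  by rewrite /in_diagram /= (leq_trans inl) // nth_parts_anti // ltnW.
have [|m' em'] := @syt_surj (row_of F l, col_of F k).
  by rewrite /in_diagram /= (leq_trans _ inl) // ltnW.
have mr : row_of F m = row_of F k by rewrite /row_of em.
have mc : col_of F m = col_of F l by rewrite /col_of em.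
have mr' : row_of F m' = row_of F l by rewrite /row_of em'.
have mc' : col_of F m' = col_of F k by rewrite /col_of em'.
have km : (k < m)%N by apply: F_row; rewrite ?mr ?mc.
have km' : (k < m')%N by apply: F_col; rewrite ?mr' ?mc'.
have ml : (m < l)%N by apply: F_col; rewrite ?mr ?mc.
have ml' : (m' < l)%N by apply: F_row; rewrite ?mr' ?mc'.
have mm : m <> m' :> nat by move/val_inj => e'; move: mr; rewrite e' mr'; lia.
by lia.
Qed.

Lemma syt_diag k l : cont_of F k = cont_of F l -> (k < l)%N -> (k.+2 < l)%N.
Proof.
move=> e kl; case: (ltngtP (row_of F k) (row_of F l)) => [|lt|er].
- exact: syt_diag_row.
- by have := syt_diag_row (esym e) lt; lia.
- suff kl' : k = l by rewrite kl' ltnn in kl.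
  apply: syt_rc_inj => //; move: e er.
  by rewrite /cont_of /content /row_of /col_of; lia.
Qed.

Lemma swap_syt (k l : 'I_n) : l = k.+1 :> nat ->
  is_syt lam (swap k l F) \/ `|cont_of F l - cont_of F k| = 1.
Proof.
move=> ekl; case: (eqVneq (row_of F k) (row_of F l)) => [er|ner].
  right; have cl : (col_of F k < col_of F l)%N.
    rewrite ltn_neqAle; apply/andP; split.
      by apply/eqP => ec; have := syt_rc_inj er ec => e; rewrite e in ekl; lia.
    by rewrite leqNgt; apply/negP => h; have := F_row (esym er) h; lia.
  suff : col_of F l = (col_of F k).+1.
    by move: er; rewrite /cont_of /content /row_of /col_of; lia.
  apply/eqP; rewrite eqn_leq cl andbT leqNgt; apply/negP => h.
  have [|m em] := @syt_surj (row_of F k, (col_of F k).+1).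
    by have := F_in l; rewrite /in_diagram er /= => /(leq_trans _)->//; exact: ltnW.
  have mr : row_of F m = row_of F k by rewrite /row_of em.
  have mc : col_of F m = (col_of F k).+1 by rewrite /col_of em.
  have km : (k < m)%N by apply: F_row; rewrite ?mr ?mc.
  have ml : (m < l)%N by apply: F_row; rewrite ?mr ?mc.
  by lia.
case: (eqVneq (col_of F k) (col_of F l)) => [ec|nec].
  right; have cl : (row_of F k < row_of F l)%N.
    rewrite ltn_neqAle ner.
    by rewrite leqNgt; apply/negP => h; have := F_col (esym ec) h; lia.
  suff : row_of F l = (row_of F k).+1.
    by move: ec; rewrite /cont_of /content /row_of /col_of; lia.
  apply/eqP; rewrite eqn_leq cl andbT leqNgt; apply/negP => h.
  have [|m em] := @syt_surj ((row_of F k).+1, col_of F k).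
    have := F_in l; rewrite /in_diagram -/(col_of F l) -/(row_of F l) -ec /=.
    by move=> /leq_trans; apply; apply: nth_parts_anti; exact: ltnW.
  have mr : row_of F m = (row_of F k).+1 by rewrite /row_of em.
  have mc : col_of F m = col_of F k by rewrite /col_of em.
  have km : (k < m)%N by apply: F_col; rewrite ?mr ?mc.
  have ml : (m < l)%N by apply: F_col; rewrite ?mr ?mc.
  by lia.
left.
have bs i : box (swap k l F) i = box F (tperm k l i) by rewrite /box !ffunE.
have ord i j : (tperm k l i < tperm k l j)%N ->
    ((i < j)%N || ((i == l) && (j == k))).
  have vne (a b : 'I_n) : a <> b -> a <> b :> nat by move=> ab /val_inj.
  rewrite -!val_eqE /=.
  by case: (tpermP k l i) => [->|->|/vne ik /vne il];
    case: (tpermP k l j) => [->|->|/vne jk /vne jl]; lia.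
apply/and4P; split.
- apply/injectiveP => i j; rewrite !ffunE => /F_inj; exact: perm_inj.
- by apply/forallP => i; rewrite bs.
- apply/forallP => i; apply/forallP => j; apply/implyP.
  rewrite /row_of /col_of !bs => /andP[/eqP e1 e2].
  have /orP[//|/andP[/eqP ei /eqP ej]] := ord _ _ (F_row e1 e2).
  by move: e1; rewrite ei ej tpermL tpermR; move/eqP: ner.
- apply/forallP => i; apply/forallP => j; apply/implyP.
  rewrite /row_of /col_of !bs => /andP[/eqP e1 e2].
  have /orP[//|/andP[/eqP ei /eqP ej]] := ord _ _ (F_col e1 e2).
  by move: e1; rewrite ei ej tpermL tpermR; move/eqP: nec.
Qed.

End Standard.

Lemma tab_inj : injective (@tab n lam).
Proof.
move=> i j; rewrite /tab => /eqP; set t := (X in tnth X); move/eqP.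
have ut : uniq t by rewrite sort_uniq enum_uniq.
by move/(tuple_uniqP _ ut).
Qed.

Lemma tab_surj T : exists i, @tab n lam i = T.
Proof.
have : T \in [tuple of sort (@ll_le n lam) (enum_tuple (syt lam))].
  by rewrite mem_sort mem_enum.
by case/tnthP => i ->; exists i.
Qed.

End StandardFillings.

Lemma braid_identity (K : fieldType) (x y a b c e0 e1 e2 e3 e4 e5 : K) :
    x != 0 -> y != 0 -> x + y != 0 ->
    a ^+ 2 = 1 - (x ^+ 2)^-1 -> b ^+ 2 = 1 - (y ^+ 2)^-1 ->
  x^-1 * (y^-1 * (x^-1 * e0 + a * e1) + b * ((x + y)^-1 * e2 + c * e3)) +
  a * ((x + y)^-1 * (- x^-1 * e1 + a * e0) + c * (y^-1 * e4 + b * e5)) =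
  y^-1 * (x^-1 * (y^-1 * e0 + b * e2) + a * ((x + y)^-1 * e1 + c * e4)) +
  b * ((x + y)^-1 * (- y^-1 * e2 + b * e0) + c * (x^-1 * e3 + a * e5)).
Proof.
move=> x0 y0 xy0 ha hb.
have {}ha : a ^+ 2 = 1 - x^-1 ^+ 2 by rewrite ha exprVn.
have {}hb : b ^+ 2 = 1 - y^-1 ^+ 2 by rewrite hb exprVn.
have hz : (x + y)^-1 * (y^-1 + x^-1) = x^-1 * y^-1 by field; rewrite xy0 x0 y0.
set X := x^-1 in ha hb hz *; set Y := y^-1 in ha hb hz *.
set Z := (x + y)^-1 in hz *.
apply/eqP; rewrite -subr_eq0; apply/eqP.
transitivity ((Y - X) * e0 * (Z * (Y + X) - X * Y)
  + (a ^+ 2 - (1 - X ^+ 2)) * Z * e0 - (b ^+ 2 - (1 - Y ^+ 2)) * Z * e0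
  + (a * e1 - b * e2) * (X * Y - Z * (Y + X))); first by ring.
by rewrite hz ha hb !subrr !(mul0r, mulr0) subr0 !addr0.
Qed.

Section YoungRep.
Variables (R : realType) (n : nat) (lam : intpart n).
Implicit Types (F : filling n) (k l m : 'I_n) (M : 'M[R]_(dim_part lam)).

Let dist k l F : R := (cont_of F l - cont_of F k)%:~R.
Let Q (d : R) : R := Num.sqrt (1 - (d ^+ 2)^-1).
Let ev M j F : R := \sum_i (val (tab i) == F)%:R * M i j.

Let op k l (v : filling n -> R) F : R :=
  (dist k l F)^-1 * v F + Q (dist k l F) * v (swap k l F).

Lemma ev_tab M i j : ev M j (val (tab i)) = M i j.
Proof.
rewrite /ev (bigD1 i) //= eqxx mul1r big1 ?addr0 // => i' /negPf ii'.
by rewrite (inj_eq val_inj) (inj_eq (@tab_inj n lam)) ii' mul0r.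
Qed.

Lemma ev_nstd M j F : ~~ is_syt lam F -> ev M j F = 0.
Proof.
move=> nF; rewrite /ev big1 // => i _; case: eqP => [e|]; last by rewrite mul0r.
by move: nF; rewrite -e (valP (tab i)).
Qed.

Lemma ev_gen M j k l F : l = k.+1 :> nat -> is_syt lam F ->
  ev (young_gen R lam k l *m M) j F = op k l (ev M j) F.
Proof.
move=> ekl stdF; have [i ei] := @tab_surj n lam (Sub F stdF).
have {ei stdF} <- : val (tab i) = F by rewrite ei.
rewrite /op !ev_tab mxE (bigD1 i) //= mxE eqxx; congr (_ + _).
have /negPf ne : val (tab i) != swap k l (val (tab i)).
  apply/negP => /eqP e.
  have /and4P[/injectiveP inj _ _ _] := valP (tab i).
  move/ffunP/(_ k): e; rewrite ffunE tpermL => /inj e.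
  by move: ekl; rewrite e; lia.
rewrite /ev [X in Q _ * X](bigD1 i) //= ne mul0r add0r.
rewrite big_distrr /=; apply: eq_bigr => i' /negPf ii'.
by rewrite mxE ii' /=; case: eqP => _; rewrite ?mul1r // !mul0r mulr0.
Qed.

Lemma QN d : Q (- d) = Q d. Proof. by rewrite /Q sqrrN. Qed.

Lemma sqr_Q (z : int) : z != 0 -> Q z%:~R ^+ 2 = 1 - (z%:~R ^+ 2)^-1.
Proof.
move=> z0; rewrite sqr_sqrtr // subr_ge0 invf_le1 -rmorphXn /=.
  by rewrite ler1z; nia.
by rewrite ltr0z; nia.
Qed.

Lemma Q1 (z : int) : `|z| = 1 -> Q z%:~R = 0.
Proof.
move=> h; have z2 : z ^+ 2 = 1 by rewrite -(real_normK (num_real z)) h expr1n.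
by rewrite /Q -rmorphXn /= z2 invr1 subrr sqrtr0.
Qed.

Lemma Q_swap k l F : l = k.+1 :> nat -> is_syt lam F ->
  Q (dist k l F) = 0 \/ is_syt lam (swap k l F).
Proof.
move=> ekl stdF; have [] := swap_syt stdF ekl; first by right.
by left; apply: Q1.
Qed.

Lemma dist_neq0 k l F : is_syt lam F -> (k < l)%N -> (l <= k.+2)%N ->
  cont_of F l - cont_of F k != 0.
Proof.
move=> stdF kl lk; rewrite subr_eq0; apply/eqP => e.
by have := syt_diag stdF (esym e) kl; rewrite ltnNge lk.
Qed.

Lemma cont_swap k l F i : cont_of (swap k l F) i = cont_of F (tperm k l i).
Proof. by rewrite /cont_of /box !ffunE. Qed.

Lemma dist_swap k l F a b :
  dist a b (swap k l F) = dist (tperm k l a) (tperm k l b) F.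
Proof. by rewrite /dist !cont_swap. Qed.

Lemma dist_opp k l F : dist k l F = - dist l k F.
Proof. by rewrite /dist -mulrNz [in RHS]opprB. Qed.

Lemma swapK k l F : swap k l (swap k l F) = F.
Proof. by apply/ffunP => i; rewrite !ffunE tpermK. Qed.

Lemma op_ext v w k l F : l = k.+1 :> nat ->
    (forall G, is_syt lam G -> v G = w G) -> is_syt lam F ->
  op k l v F = op k l w F.
Proof.
move=> ekl vw stdF; rewrite /op vw //; congr (_ + _).
by have [->|/vw->] := Q_swap ekl stdF; rewrite ?mul0r.
Qed.

Lemma mx_ev M1 M2 :
  (forall j F, is_syt lam F -> ev M1 j F = ev M2 j F) -> M1 = M2.
Proof. by move=> h; apply/matrixP => i j; rewrite -!ev_tab h // (valP (tab i)). Qed.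

Lemma young_genK k l : l = k.+1 :> nat ->
  young_gen R lam k l *m young_gen R lam k l = 1%:M.
Proof.
move=> ekl; apply: mx_ev => j F stdF.
rewrite -[_ *m _]mulmx1 -mulmxA (ev_gen _ _ ekl stdF).
rewrite (op_ext ekl (fun G => ev_gen 1%:M j ekl (F := G)) stdF) /op.
rewrite swapK dist_swap tpermL tpermR (dist_opp l k) QN invrN.
have d0 : cont_of F l - cont_of F k != 0 by apply: dist_neq0; lia.
have := sqr_Q d0; rewrite -/(dist k l F) => q2.
set d := dist _ _ _ in q2 *; set e1 := ev _ _ F; set e2 := ev _ _ _.
transitivity ((d ^+ 2)^-1 * e1 + Q d ^+ 2 * e1); first by rewrite -exprVn; ring.
by rewrite q2 mulrBl mul1r subrKC.
Qed.

Lemma young_genC k l k' l' :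
    l = k.+1 :> nat -> l' = k'.+1 :> nat -> (l < k')%N ->
  young_gen R lam k l *m young_gen R lam k' l' =
  young_gen R lam k' l' *m young_gen R lam k l.
Proof.
move=> ekl ekl' kk'; apply: mx_ev => j F stdF.
rewrite -[X in ev X j F = _]mulmx1 -[X in _ = ev X j F]mulmx1 -!mulmxA.
rewrite (ev_gen _ _ ekl stdF) (ev_gen _ _ ekl' stdF).
rewrite (op_ext ekl (fun G => ev_gen 1%:M j ekl' (F := G)) stdF).
rewrite (op_ext ekl' (fun G => ev_gen 1%:M j ekl (F := G)) stdF) /op.
have vne (a b : 'I_n) : a != b :> nat -> a != b by rewrite val_eqE.
have [n1 n2 n3 n4] : [/\ k != k', k != l', l != k' & l != l'].
  by split; apply: vne; lia.
rewrite !dist_swap !(tpermD n1 n3) !(tpermD n2 n4).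
have [m1 m2 m3 m4] : [/\ k' != k, l' != k, k' != l & l' != l].
  by split; apply: vne; lia.
rewrite !(tpermD m1 m2) !(tpermD m3 m4).
have -> : swap k' l' (swap k l F) = swap k l (swap k' l' F).
  apply/ffunP => i; rewrite !ffunE -!permM; congr (F (fun_of_perm _ i)).
  by rewrite [LHS]conjgC tpermJ !tpermD.
ring.
Qed.

Lemma young_gen_braid k l m : l = k.+1 :> nat -> m = l.+1 :> nat ->
  young_gen R lam k l *m young_gen R lam l m *m young_gen R lam k l =
  young_gen R lam l m *m young_gen R lam k l *m young_gen R lam l m.
Proof.
move=> ekl elm; apply: mx_ev => j F stdF.
rewrite -[X in ev X j F = _]mulmx1 -[X in _ = ev X j F]mulmx1 -!mulmxA.
rewrite (ev_gen _ _ ekl stdF) (ev_gen _ _ elm stdF).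
have opk M G := @ev_gen M j k l G ekl.
have opl M G := @ev_gen M j l m G elm.
rewrite (op_ext ekl (opl _) stdF) (op_ext elm (opk _) stdF).
rewrite (op_ext ekl (fun G => op_ext elm (opk _)) stdF).
rewrite (op_ext elm (fun G => op_ext ekl (opl _)) stdF) /op.
have vne (a b : 'I_n) : a != b :> nat -> a != b by rewrite val_eqE.
have [kl lm km] : [/\ k != l, l != m & k != m] by split; apply: vne; lia.
have tm : tperm k l m = m by rewrite tpermD.
have tk : tperm l m k = k by rewrite tpermD // eq_sym.
rewrite !dist_swap !(tm, tk, tpermL, tpermR).
rewrite !swapK.
have -> : swap k l (swap l m (swap k l F)) = swap l m (swap k l (swap l m F)).
  apply/ffunP => i; rewrite !ffunE -!permM; congr (F (fun_of_perm _ i)).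
  have := tpermJ l m (tperm k l); have := tpermJ k l (tperm l m).
  by rewrite !conjgE !tpermV tpermL tpermR tm tk !mulgA => -> ->.
have dkl : cont_of F l - cont_of F k != 0 by apply: dist_neq0; lia.
have dlm : cont_of F m - cont_of F l != 0 by apply: dist_neq0; lia.
have dkm : cont_of F m - cont_of F k != 0 by apply: dist_neq0; lia.
have Qkl := sqr_Q dkl; have Qlm := sqr_Q dlm.
rewrite (dist_opp l k) (dist_opp m l) !QN !invrN.
rewrite -/(dist k l F) in Qkl; rewrite -/(dist l m F) in Qlm.
have ekm : dist k m F = dist k l F + dist l m F.
  by rewrite /dist -intrD; congr (_%:~R); ring.
have Dkl : dist k l F != 0 by rewrite intr_eq0.
have Dlm : dist l m F != 0 by rewrite intr_eq0.
have Dkm : dist k m F != 0 by rewrite intr_eq0.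
rewrite ekm in Dkm *.
exact: braid_identity.
Qed.


Definition gen_mx (k : nat) : 'M[R]_(dim_part lam) :=
  if (insub k, insub k.+1) is (Some i, Some j) then young_gen R lam i j
  else 1%:M.

Lemma gen_mxE k l : l = k.+1 :> nat -> gen_mx k = young_gen R lam k l.
Proof. by move=> ekl; rewrite /gen_mx -ekl !valK. Qed.

Lemma young_rep_exists :
  exists p : 'S_n -> 'M[R]_(dim_part lam), is_young_rep p.
Proof.
have [k hk|k hk|k l kl hl|p [p1 pM pA]] :=
    @coxeter_ext 'M[R]_(dim_part lam) gen_mx n.
- rewrite (@gen_mxE (Ordinal (ltnW hk)) (Ordinal hk)) //.
  exact: young_genK.
- rewrite (@gen_mxE (Ordinal (ltnW (ltnW hk))) (Ordinal (ltnW hk))) //.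
  rewrite (@gen_mxE (Ordinal (ltnW hk)) (Ordinal hk)) //.
  exact: young_gen_braid.
- have hk : (k.+1 < n)%N by apply: ltn_trans hl; apply: ltnW.
  rewrite (@gen_mxE (Ordinal (ltnW hk)) (Ordinal hk)) //.
  rewrite (@gen_mxE (Ordinal (ltnW hl)) (Ordinal hl)) //.
  exact: young_genC.
exists (fun s => p s^-1%g); split=> [|s t|k l ekl]; first by rewrite invg1.
  by rewrite invMg pM.
by rewrite tpermV (pA _ _ ekl) (gen_mxE ekl).
Qed.

Lemma young_rep_unique (p q : 'S_n -> 'M[R]_(dim_part lam)) :
  is_young_rep p -> is_young_rep q -> p =1 q.
Proof.
move=> [p1 pM pA] [q1 qM qA]; apply: adjacent_ind => [|s t es et|k l ekl].
- by rewrite p1 q1.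
- by rewrite pM qM es et.
- by rewrite pA // qA.
Qed.

(* Young's orthogonal form: is_young_rep has exactly one solution. *)
Definition young_rep : 'S_n -> 'M[R]_(dim_part lam) := sval (cid young_rep_exists).

Lemma young_repP : is_young_rep young_rep.
Proof. exact: svalP (cid young_rep_exists). Qed.

Definition chi (s : 'S_n) : R := \tr (young_rep s).

Definition chi_hat (s : 'S_n) : R := chi s / (dim_part lam)%:R.

(* tab i is the (i+1)-st tableau in the last letter order. *)
Definition PT (u : R) (s : 'S_n) : R :=
  \sum_(i < dim_part lam | i.+1%:R <= u * (dim_part lam)%:R)
    young_rep s i i / (dim_part lam)%:R.

End YoungRep.

Section WidenPerm.

Variables (r n : nat) (le_rn : (r <= n)%N).

Definition widen_perm_fun (s : 'S_r) (i : 'I_n) : 'I_n :=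
  if insub (val i) is Some j then widen_ord le_rn (s j) else i.

Lemma widen_perm_subproof s : injective (widen_perm_fun s).
Proof.
move=> i j; rewrite /widen_perm_fun.
case: insubP => [a _ ea|ia]; case: insubP => [b _ eb|jb] //.
- move/(congr1 val) => /= /val_inj/perm_inj ab.
  by apply: val_inj; rewrite -ea -eb ab.
- by move=> e; move: jb; rewrite -e /= ltn_ord.
- by move=> e; move: ia; rewrite e /= ltn_ord.
Qed.

Definition widen_perm (s : 'S_r) : 'S_n := perm (@widen_perm_subproof s).

End WidenPerm.

Section Corners.

Variables (n : nat) (lam : intpart n).

Definition removable (b : nat) : bool := (nth 0 lam b.+1 < nth 0 lam b)%N.

Definition corner_content (b : nat) : int := content (b, (nth 0 lam b).-1)%N.

(* The rows of the corners, by increasing content of the corner. *)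
Definition corners : seq nat :=
  sort (fun b c => corner_content b <= corner_content c)
    [seq b <- iota 0 (size lam) | removable b].

Definition ncorners : nat := size corners.

Definition corner_row (j : 'I_ncorners) : nat := nth 0%N corners j.

Definition y_cont (j : 'I_ncorners) : int := corner_content (corner_row j).

Definition remove_corner (b : nat) : seq nat :=
  [seq x <- set_nth 0%N lam b (nth 0%N lam b).-1 | x != 0%N].

Lemma corner_rowP j : removable (corner_row j).
Proof.
have : corner_row j \in corners by apply: mem_nth.
by rewrite mem_sort mem_filter => /andP[].
Qed.

Lemma remove_corner_intpart b : removable b -> is_intpart n.-1 (remove_corner b).
Proof.
move=> rb; apply/and3P; split.
- apply: sorted_filter => [x y' z /= xy yz|]; first exact: leq_trans xy.
  apply/(sortedP 0%N) => i _; rewrite !nth_set_nth /= /geq /=.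
  have le k := @nth_parts_anti n lam k k.+1 (leqnSn k).
  have := le i; move: rb; rewrite /removable => rb lei.
  by case: eqP => [e1|_]; case: eqP => [e2|_]; rewrite ?e1 ?e2 in lei rb *; lia.
- by rewrite mem_filter eqxx.
- have /and3P[_ _ /eqP sn] := partsP lam.
  suff -> : sumn (remove_corner b) = sumn (set_nth 0%N lam b (nth 0%N lam b).-1).
    have b_lt : (b < size lam)%N.
      by rewrite ltnNge; apply/negP => hb; move: rb;
        rewrite /removable (nth_default _ hb).
    have := @in_diagram_lt n lam (b, (nth 0%N lam b).-1).
    move: rb; rewrite sumn_set_nth sn b_lt muln1 /in_diagram /removable /=.
    by move=> rb hb; have /andP[_ {}hb] := hb ltac:(lia); lia.
  rewrite /remove_corner; elim: (set_nth _ _ _ _) => //= x s IHs.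
  by case: eqP => [->|_] /=; rewrite IHs.
Qed.

Definition mu (j : 'I_ncorners) : intpart n.-1 :=
  IntPart (remove_corner_intpart (corner_rowP j)).

Variable R : realType.

Definition dim_ratio (j : 'I_ncorners) : R :=
  (dim_part (mu j))%:R / (dim_part lam)%:R.

Definition F_ct (v : R) : R :=
  \sum_(j < ncorners | (y_cont j)%:~R <= v * Num.sqrt n%:R) dim_ratio j.

Definition F_ct_star (u : R) : R := sup [set z : R | F_ct z <= u]%classic.

Definition u_bar (u : R) (jbar : 'I_ncorners) : R :=
  (dim_part lam)%:R / (dim_part (mu jbar))%:R
    * (u - \sum_(j < ncorners | (j < jbar)%N) dim_ratio j).

End Corners.

(* Main.v *)
Require Import Defs.
From mathcomp Require Import all_boot all_order all_algebra all_fingroup.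
From mathcomp Require Import zify ring lra.
From mathcomp Require Import classical_sets reals.

Set Implicit Arguments.
Unset Strict Implicit.
Unset Printing Implicit Defensive.

Import Order.TTheory GRing.Theory Num.Theory.

Local Open Scope ring_scope.

(* Removing the largest entry identifies the standard tableaux of lam with     *)
(* the disjoint union over the corners of those of the mu j. The last letter   *)
(* order first compares the row of the largest entry, so each mu j occupies    *)
(* an interval, these intervals follow each other by increasing content, and   *)
(* inside each one the order is that of mu j. Permutations fixing the largest  *)
(* entry act block-diagonally, and the block of mu j satisfies the relations   *)
(* that characterise Young's orthogonal form of mu j. The cut of the partial   *)
(* trace at u * dim lam falls inside the interval of the corner at which F_ct  *)
(* jumps over u.                                                               *)

(** The statement is the branching rule for Young's orthogonal form, read along the diagonal.
    Counting from 0, tableau i of [mu j] has index N_j + i among those of [lam], where N_j is the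
    total dimension of the earlier blocks ([ext_index_val]), and for permutations fixing the largest
    entry the two diagonal entries agree ([young_rep_ext_index]). So the partial trace is a sum over
    blocks with one common cut at u dim lam ([PT_branching]).

    Let j be the jump index of the theorem. Its description by a supremum yields N_j <= u dim lam <
    N_j + dim (mu j) ([F_ct_star_bracket]). Blocks before j are then summed completely and give
    normalised characters, blocks after j contribute nothing, and block j is cut at u dim lam - N_j,
    which is [u_bar u j] times dim (mu j) ([PT_bracket]). *)

Lemma nth_filter_neq0 (s : seq nat) (i : nat) : sorted geq s ->
  nth 0%N [seq x <- s | x != 0%N] i = nth 0%N s i.
Proof.
elim: s i => [|x s IHs] i //= xs; have geq_tr : transitive geq.
  by move=> a b c /= ab bc; apply: leq_trans ab.
have ss := path_sorted xs; have /allP sx := order_path_min geq_tr xs.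
case: eqP => [x0|_] /=; last by case: i => //= i; apply: IHs.
(* A leading 0 forces the whole tail to be 0, which is also the default value of [nth]. *)
rewrite IHs //; have s0 k : nth 0%N s k = 0%N.
  have [ks|] := ltnP k (size s); last by move/(nth_default 0%N).
  by have := sx _ (mem_nth 0%N ks); rewrite x0 /=; lia.
by case: i => [|i] /=; rewrite !s0.
Qed.

(** A removable row is strictly longer than the next one, so the shortened list is still
    nonincreasing and the filter in [remove_corner] drops trailing zeros only. *)
Lemma in_diagram_remove_corner (n : nat) (lam : intpart n) (b : nat)
    (x : nat * nat) : removable lam b ->
  in_diagram (remove_corner lam b) x =
    in_diagram lam x && (x != (b, (nth 0%N lam b).-1)).
Proof.
move=> rb; case: x => i c; rewrite /in_diagram /remove_corner nth_filter_neq0.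
  rewrite nth_set_nth /= xpair_eqE /=; move: rb; rewrite /removable.
  by case: eqP => [->|_] /=; [lia | rewrite andbT].
apply/(sortedP 0%N) => k _; rewrite !nth_set_nth /= /geq /=.
have := @nth_parts_anti n lam k k.+1 (leqnSn k); move: rb; rewrite /removable.
by case: eqP => [->|_]; case: eqP => [->|_]; lia.
Qed.

(** * The last letter order is a partial order *)

Section LastLetterOrder.

Variables (n : nat) (lam : intpart n).
Implicit Types T S U : syt lam.

Lemma ll_ltP T S : reflect
  (exists2 k : 'I_n, (row_of (val S) k < row_of (val T) k)%N
    & forall l : 'I_n, (k < l)%N -> row_of (val T) l = row_of (val S) l)
  (ll_lt T S).
Proof.
apply: (iffP existsP) => [[k /andP[kTS /forallP h]]|[k kTS h]]; exists k => //.
  by move=> l kl; apply/eqP; have /implyP := h l; apply.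
by rewrite kTS; apply/forallP => l; apply/implyP => kl; rewrite h.
Qed.

Lemma ll_lt_irr : irreflexive (@ll_lt n lam).
Proof. by move=> T; apply/ll_ltP => -[k]; rewrite ltnn. Qed.

Lemma ll_lt_trans : transitive (@ll_lt n lam).
Proof.
move=> T S U /ll_ltP[k kST hST] /ll_ltP[l lTU hTU]; apply/ll_ltP.
case: (ltngtP k l) => [kl|lk|/val_inj ekl].
- exists l => [|i li]; first by rewrite hST.
  by rewrite hST ?hTU // (ltn_trans kl).
- exists k => [|i ki]; first by rewrite -hTU.
  by rewrite hST ?hTU // (ltn_trans lk).
- subst l; exists k => [|i ki]; first exact: ltn_trans lTU kST.
  by rewrite hST ?hTU.
Qed.

Lemma ll_le_trans : transitive (@ll_le n lam).
Proof.
move=> T S U /orP[/eqP->//|ST] /orP[/eqP<-|TU]; rewrite /ll_le ?ST ?orbT //.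
by rewrite (ll_lt_trans ST TU) orbT.
Qed.

Lemma ll_le_anti : antisymmetric (@ll_le n lam).
Proof.
move=> T S /andP[/orP[/eqP//|TS] /orP[/eqP//|ST]].
by have := ll_lt_trans TS ST; rewrite ll_lt_irr.
Qed.

End LastLetterOrder.

(** * Corners: increasing content is decreasing row *)

Section Corners.

Variables (n : nat) (lam : intpart n).

Lemma corner_content_lt (b c : nat) : removable lam b -> (b < c)%N ->
  corner_content lam c < corner_content lam b.
Proof.
rewrite /removable /corner_content /content /= => rb bc.
by have := @nth_parts_anti n lam _ _ bc; lia.
Qed.

(** Sorting gives a weak inequality of contents. The listed rows are distinct, and content strictly
    decreases down the corners, so the rows are strictly ordered. This ties the numbering of the
    corners to the last letter order, where the lower row comes first. *)
Lemma corner_row_lt (i j : 'I_(ncorners lam)) :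
  (corner_row j < corner_row i)%N = (i < j)%N.
Proof.
have ij_lt (k l : 'I_(ncorners lam)) :
    (k < l)%N -> (corner_row l < corner_row k)%N.
  move=> kl; have := corner_rowP l; have := corner_rowP k => rk rl.
  set leT := fun b c => corner_content lam b <= corner_content lam c.
  have tr : transitive leT by move=> x y z; apply: le_trans.
  have /(sorted_ltn_nth tr) sc : sorted leT (corners lam).
    by apply: sort_sorted => x y; apply: le_total.
  have := sc 0%N k l (ltn_ord k) (ltn_ord l) kl.
  rewrite /leT -/(corner_row k) -/(corner_row l) => cle.
  have : corner_row k != corner_row l.
    rewrite /corner_row nth_uniq ?neq_ltn ?kl // sort_uniq filter_uniq //.
    exact: iota_uniq.
  case: (ltngtP (corner_row k) (corner_row l)) => // rkl _.
  by have := @corner_content_lt _ _ rk rkl; rewrite ltNge cle.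
case: (ltngtP i j) => [/ij_lt//|/ij_lt|/val_inj->]; last by rewrite ltnn.
by move=> h; apply/negbTE; rewrite -leqNgt ltnW.
Qed.

Lemma corner_row_inj : injective (@corner_row n lam).
Proof.
move=> i j e; have := corner_row_lt i j; have := corner_row_lt j i.
by rewrite e ltnn; case: (ltngtP i j) => // /val_inj.
Qed.

Lemma y_cont_lt (i j : 'I_(ncorners lam)) : (y_cont i < y_cont j) = (i < j)%N.
Proof.
have lt_y (k l : 'I_(ncorners lam)) : (k < l)%N -> y_cont k < y_cont l.
  move=> kl; apply: corner_content_lt; first exact: corner_rowP.
  by rewrite corner_row_lt.
case: (ltngtP i j) => [/lt_y//|/lt_y h|/val_inj->]; last by rewrite ltxx.
by apply/negbTE; rewrite -leNgt ltW.
Qed.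

Lemma corner_row_surj (b : nat) : removable lam b ->
  exists j : 'I_(ncorners lam), corner_row j = b.
Proof.
move=> rb; have bc : b \in corners lam.
  rewrite mem_sort mem_filter rb mem_iota /= add0n ltnNge.
  by apply/negP => /(nth_default 0%N) h; move: rb; rewrite /removable h.
have jc : (index b (corners lam) < ncorners lam)%N by rewrite index_mem.
by exists (Ordinal jc); rewrite /corner_row nth_index.
Qed.

End Corners.

(** * Adding and removing the largest entry *)

Section Branching.

Variable m : nat.

(** [lift ord_max] keeps the underlying number; it serves both for entries and for coordinates. *)
Definition ext_filling (b : 'I_m.+1 * 'I_m.+1) (F : filling m) : filling m.+1 :=
  [ffun k => if unlift ord_max k is Some i
             then (lift ord_max (F i).1, lift ord_max (F i).2) else b].

Lemma box_ext_lift b F (i : 'I_m) : box (ext_filling b F) (lift ord_max i) = box F i.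
Proof. by rewrite /box ffunE liftK; congr (_, _); apply: lift_max. Qed.

Lemma box_ext_max b F : box (ext_filling b F) ord_max = (val b.1, val b.2).
Proof. by rewrite /box ffunE unlift_none. Qed.

Lemma ext_filling_inj b : injective (ext_filling b).
Proof.
move=> F G /ffunP eFG; apply/ffunP => i.
have := eFG (lift ord_max i); rewrite !ffunE !liftK => e.
have /lift_inj := congr1 fst e; have /lift_inj := congr1 snd e.
by case: (F i) (G i) => ? ? [? ?] /= -> ->.
Qed.

Lemma box_inj p (F : filling p) : injective F -> injective (box F).
Proof.
move=> Finj i j [e1 e2]; apply: Finj.
by case: (F i) (F j) e1 e2 => [? ?] [? ?] /= /val_inj-> /val_inj->.
Qed.

Variable lam : intpart m.+1.
Implicit Types j : 'I_(ncorners lam).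

Definition corner_box j : 'I_m.+1 * 'I_m.+1 :=
  (inord (corner_row j), inord (nth 0%N lam (corner_row j)).-1).

Lemma in_diagram_corner j :
  in_diagram lam (corner_row j, (nth 0%N lam (corner_row j)).-1).
Proof. by have := corner_rowP j; rewrite /removable /in_diagram /=; lia. Qed.

Lemma box_ext_corner j F : box (ext_filling (corner_box j) F) ord_max =
  (corner_row j, (nth 0%N lam (corner_row j)).-1).
Proof.
have /andP[h1 h2] := in_diagram_lt (in_diagram_corner j).
by rewrite box_ext_max /= !inordK.
Qed.

Lemma in_diagram_mu j x : in_diagram (mu j) x =
  in_diagram lam x && (x != (corner_row j, (nth 0%N lam (corner_row j)).-1)).
Proof. exact/in_diagram_remove_corner/corner_rowP. Qed.

(** The new entry respects the order conditions because no box of the diagram lies to the right of a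
    corner or below it. *)
Lemma ext_syt_proof j (T : syt (mu j)) :
  is_syt lam (ext_filling (corner_box j) (val T)).
Proof.
case: T => F /= /and4P[/injectiveP Finj /forallP Fin /forallP Frow /forallP Fcol].
have {}Fin k : in_diagram lam (box F k) &&
    (box F k != (corner_row j, (nth 0%N lam (corner_row j)).-1)).
  by rewrite -in_diagram_mu; apply: Fin.
have rj := corner_rowP j; rewrite /removable in rj.
set G := ext_filling _ _; have Gl k : box G (lift ord_max k) = box F k.
  exact: box_ext_lift.
have Gm : box G ord_max = (corner_row j, (nth 0%N lam (corner_row j)).-1).
  exact: box_ext_corner.
apply/and4P; split.
- suff Ginj : injective (box G).
    by apply/injectiveP => x y exy; apply: Ginj; rewrite /box exy.
  move=> x y; case: (unliftP ord_max x) => [k|] ->;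
    case: (unliftP ord_max y) => [l|] -> //; rewrite ?Gl ?Gm.
  + by move/(box_inj Finj) ->.
  + by move=> e; have /andP[_] := Fin k; rewrite e eqxx.
  + by move=> e; have /andP[_] := Fin l; rewrite -e eqxx.
- apply/forallP => x; case: (unliftP ord_max x) => [k|] ->; rewrite ?Gl ?Gm.
    by have /andP[] := Fin k.
  exact: in_diagram_corner.
- apply/forallP => x; apply/forallP => y; apply/implyP; rewrite /row_of /col_of.
  case: (unliftP ord_max x) => [k|] ->; case: (unliftP ord_max y) => [l|] ->;
    rewrite ?Gl ?Gm ?lift_max.
  + by move=> h; have /forallP/(_ l)/implyP := Frow k; apply.
  + by move=> _; exact: ltn_ord.
  + move=> /andP[/eqP e1 e2]; have /andP[] := Fin l.
    by rewrite /in_diagram -e1 /=; move: e2; rewrite /=; lia.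
  + by rewrite ltnn andbF.
- apply/forallP => x; apply/forallP => y; apply/implyP; rewrite /row_of /col_of.
  case: (unliftP ord_max x) => [k|] ->; case: (unliftP ord_max y) => [l|] ->;
    rewrite ?Gl ?Gm ?lift_max.
  + by move=> h; have /forallP/(_ l)/implyP := Fcol k; apply.
  + by move=> _; exact: ltn_ord.
  + move=> /andP[/eqP e1 e2]; have /andP[] := Fin l; rewrite /in_diagram -e1 /=.
    by have := @nth_parts_anti _ lam _ _ e2; move: e2 => /=; lia.
  + by rewrite ltnn andbF.
Qed.

Definition ext_syt j (T : syt (mu j)) : syt lam := Sub _ (ext_syt_proof T).

Lemma ext_syt_inj j : injective (@ext_syt j).
Proof. by move=> T S /(congr1 val) /ext_filling_inj/val_inj. Qed.

Lemma row_ext_max j (T : syt (mu j)) :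
  row_of (val (ext_syt T)) ord_max = corner_row j.
Proof. by rewrite /row_of box_ext_corner. Qed.

Lemma row_ext_lift j (T : syt (mu j)) (k : 'I_m) :
  row_of (val (ext_syt T)) (lift ord_max k) = row_of (val T) k.
Proof. by rewrite /row_of box_ext_lift. Qed.

(** The largest entry sits in a corner: a box to its right or below it would hold a larger entry. *)
Lemma ext_syt_surj (T : syt lam) : exists j, exists T' : syt (mu j), ext_syt T' = T.
Proof.
have stdT := valP T; set F := val T in stdT *.
have /and4P[/injectiveP Finj /forallP Fin /forallP Frow /forallP Fcol] := stdT.
have max_lt (k : 'I_m.+1) : (@ord_max m < k)%N -> False by have := ltn_ord k; rewrite /=; lia.
have Fm := Fin ord_max.
case ebox : (box F ord_max) Fm => [b c] Fm.
have cE : c = (nth 0%N lam b).-1.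
  apply/eqP; apply: contraTT isT => ne.
  have /(syt_surj stdT)[k ek] : in_diagram lam (b, c.+1).
    by move: Fm ne; rewrite /in_diagram /=; lia.
  have /forallP/(_ k) := Frow ord_max.
  by rewrite /row_of /col_of ebox ek eqxx ltnSn => /max_lt.
have rb : removable lam b.
  rewrite /removable ltnNge; apply/negP => h.
  have /(syt_surj stdT)[k ek] : in_diagram lam (b.+1, c).
    by move: Fm h; rewrite /in_diagram /=; lia.
  have /forallP/(_ k) := Fcol ord_max.
  by rewrite /row_of /col_of ebox ek eqxx ltnSn => /max_lt.
have [j ej] := corner_row_surj rb.
have Fmu k : in_diagram (mu j) (box F (lift ord_max k)).
  rewrite in_diagram_mu Fin ej -cE -ebox (inj_eq (box_inj Finj)).
  by rewrite eq_sym neq_lift.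
(* [k] is a mere default for [insubd]: coordinates of boxes of [mu j] are below m. *)
pose G : filling m := [ffun k : 'I_m =>
  (insubd k (box F (lift ord_max k)).1, insubd k (box F (lift ord_max k)).2)].
have Gbox k : box G k = box F (lift ord_max k).
  have /andP[h1 h2] := in_diagram_lt (Fmu k).
  by rewrite {1}/box ffunE /= !val_insubd h1 h2.
have stdG : is_syt (mu j) G.
  apply/and4P; split.
  - apply/injectiveP => x y exy; apply: (@lift_inj _ ord_max).
    by apply: (box_inj Finj); rewrite -!Gbox /box exy.
  - by apply/forallP => k; rewrite Gbox.
  - apply/forallP => x; apply/forallP => y; apply/implyP.
    rewrite /row_of /col_of !Gbox => h.
    have /forallP/(_ (lift ord_max y))/implyP/(_ h) := Frow (lift ord_max x).
    by rewrite !lift_max.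
  - apply/forallP => x; apply/forallP => y; apply/implyP.
    rewrite /row_of /col_of !Gbox => h.
    have /forallP/(_ (lift ord_max y))/implyP/(_ h) := Fcol (lift ord_max x).
    by rewrite !lift_max.
exists j, (Sub G stdG); apply/val_inj/ffunP => /= x.
suff : box (ext_filling (corner_box j) G) x = box F x.
  rewrite /box -/F => -[].
  by case: (ext_filling _ _ x) (F x) => ? ? [? ?] /= /val_inj-> /val_inj->.
case: (unliftP ord_max x) => [k|] ->; first by rewrite box_ext_lift Gbox.
by rewrite box_ext_corner ej -cE ebox.
Qed.

End Branching.

(** * The last letter order under removal of the largest entry; totality and ranks *)

Section BranchingOrder.

Variables (m : nat) (lam : intpart m.+1).
Implicit Types j : 'I_(ncorners lam).

Lemma ll_lt_ext j (T S : syt (mu j)) : ll_lt (ext_syt T) (ext_syt S) = ll_lt T S.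
Proof.
apply/ll_ltP/ll_ltP => -[k].
  case: (unliftP ord_max k) => [i|] ->; last by rewrite !row_ext_max ltnn.
  rewrite !row_ext_lift => iTS h; exists i => // l il.
  by rewrite -!row_ext_lift h // !lift_max.
move=> kTS h; exists (lift ord_max k) => [|x]; first by rewrite !row_ext_lift.
case: (unliftP ord_max x) => [l|] ->; rewrite ?row_ext_max // !lift_max => kl.
by rewrite !row_ext_lift h.
Qed.

Lemma ll_lt_ext_corner i j (T : syt (mu i)) (S : syt (mu j)) :
  (i < j)%N -> ll_lt (ext_syt T) (ext_syt S).
Proof.
move=> ij; apply/ll_ltP; exists ord_max; first by rewrite !row_ext_max corner_row_lt.
by move=> l; have := ltn_ord l; rewrite /=; lia.
Qed.

End BranchingOrder.

(** Induction on the size: different corners of the largest entry decide the comparison, equal ones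
    leave two smaller tableaux. *)
Lemma ll_lt_total n (lam : intpart n) (T S : syt lam) :
  T != S -> ll_lt T S || ll_lt S T.
Proof.
elim: n lam T S => [|m IHm] lam T S.
  by case/eqP; apply/val_inj/ffunP => -[].
have [i [T' <-]] := ext_syt_surj T; have [j [S' <-]] := ext_syt_surj S.
case: (ltngtP i j) => [/ll_lt_ext_corner->//|/ll_lt_ext_corner->|/val_inj eij].
  by rewrite orbT.
subst j; rewrite (inj_eq (@ext_syt_inj _ _ i)) !ll_lt_ext; exact: IHm.
Qed.

Lemma ll_le_total n (lam : intpart n) : total (@ll_le n lam).
Proof.
move=> T S; rewrite /ll_le [S == T]eq_sym.
by case: eqP => //= /eqP; apply: ll_lt_total.
Qed.

Lemma ll_le_tab n (lam : intpart n) (i k : 'I_(dim_part lam)) :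
  ll_le (tab i) (tab k) = (i <= k)%N.
Proof.
have tab_homo (a b : 'I_(dim_part lam)) : (a <= b)%N -> ll_le (tab a) (tab b).
  set s := [tuple of sort (@ll_le n lam) (enum_tuple (syt lam))].
  have sE T c : tab c = nth T s c by rewrite /tab (tnth_nth T).
  have [T0 _] : exists T : syt lam, True by exists (tab a).
  rewrite (sE T0 a) (sE T0 b); apply: (sorted_leq_nth (@ll_le_trans n lam)).
  - by move=> T; rewrite /ll_le eqxx.
  - exact: sort_sorted (@ll_le_total n lam) _.
  - by rewrite inE size_tuple.
  - by rewrite inE size_tuple.
apply/idP/idP => [ik|]; last exact: tab_homo.
rewrite leqNgt; apply/negP => ki.
have /tab_inj eik : tab i = tab k by apply: ll_le_anti; rewrite ik tab_homo // ltnW.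
by rewrite eik ltnn in ki.
Qed.

Lemma tab_bij n (lam : intpart n) : bijective (@tab n lam).
Proof. by apply: inj_card_bij; [exact: tab_inj | rewrite card_ord]. Qed.

(** Turns an index into a cardinal, so that positions in [lam] and in [mu j] can be compared by
    counting. *)
Lemma tab_rank n (lam : intpart n) (i : 'I_(dim_part lam)) :
  i.+1 = #|[pred T | ll_le T (tab i)]|.
Proof.
have [g tabK gK] := tab_bij lam.
rewrite -sum1_card (reindex (@tab n lam)) /=; last by exists g => x _.
under eq_bigl do rewrite inE ll_le_tab -ltnS.
by rewrite (big_ord_narrow (ltn_ord i)) sum1_card card_ord.
Qed.

(** * Positions of the tableaux of [mu j] among those of [lam] *)

Section BranchingIndex.

Variables (m : nat) (lam : intpart m.+1).
Implicit Types j : 'I_(ncorners lam).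

Lemma ext_index_proof j (i : 'I_(dim_part (mu j))) :
  {k : 'I_(dim_part lam) | tab k == ext_syt (tab i)}.
Proof. by apply: sigW; have [k <-] := tab_surj (ext_syt (tab i)); exists k. Qed.

Definition ext_index j (i : 'I_(dim_part (mu j))) : 'I_(dim_part lam) :=
  sval (ext_index_proof i).

Lemma tab_ext_index j (i : 'I_(dim_part (mu j))) : tab (ext_index i) = ext_syt (tab i).
Proof. exact/eqP/(svalP (ext_index_proof i)). Qed.

Lemma ext_index_inj j : injective (@ext_index j).
Proof.
by move=> i k /(congr1 (@tab _ lam)); rewrite !tab_ext_index => /ext_syt_inj/tab_inj.
Qed.

Lemma sum_syt_branching (V : nmodType) (G : syt lam -> V) :
  \sum_T G T = \sum_j \sum_(T : syt (mu j)) G (ext_syt T).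
Proof.
rewrite sig_big_dep /=.
rewrite (reindex (fun x : {j & syt (mu j)} => ext_syt (tagged x))) /=.
  by apply: eq_big => // -[j T].
have ex (T : syt lam) : exists x : {j & syt (mu j)}, ext_syt (tagged x) == T.
  by have [j [T' <-]] := ext_syt_surj T; exists (existT _ j T').
exists (fun T => xchoose (ex T)) => [x _|T _]; last by apply/eqP/(xchooseP (ex T)).
have /eqP := xchooseP (ex (ext_syt (tagged x))); move: (xchoose _) => {ex} y.
case: x y => [j T] [i S] /= e.
(* The row of the largest entry tells which corner was filled. *)
have eij : i = j.
  by apply: corner_row_inj; rewrite -(row_ext_max S) -(row_ext_max T) e.
by subst i; rewrite (ext_syt_inj e).
Qed.

Lemma sum_index_branching (V : nmodType) (G : 'I_(dim_part lam) -> V) :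
  \sum_i G i = \sum_j \sum_(i < dim_part (mu j)) G (ext_index i).
Proof.
have [g tabK gK] := tab_bij lam.
rewrite (reindex g) /=; last by exists (@tab _ lam) => x _.
rewrite sum_syt_branching; apply: eq_bigr => j _.
have [h htabK hK] := tab_bij (mu j).
rewrite (reindex (@tab _ (mu j))) /=; last by exists h => x _.
by apply: eq_bigr => i _; rewrite -tab_ext_index tabK.
Qed.

Lemma dim_branching : dim_part lam = (\sum_(j < ncorners lam) dim_part (mu j))%N.
Proof.
rewrite /dim_part -sum1_card [LHS](sum_syt_branching (fun=> 1%N)).
by apply: eq_bigr => j _; rewrite sum1_card.
Qed.

(** Among the tableaux up to a given one of block j are all those of earlier blocks, those of its
    own block up to it, and none of later blocks. *)
Lemma ext_index_val j (i : 'I_(dim_part (mu j))) :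
  ext_index i = (\sum_(k < ncorners lam | (k < j)%N) dim_part (mu k) + i)%N :> nat.
Proof.
apply: succn_inj; rewrite -addnS !tab_rank -!sum1_card tab_ext_index.
rewrite big_mkcond /= [LHS]sum_syt_branching (bigID (fun k : 'I_(ncorners lam) => k < j)%N) /=.
congr (_ + _)%N.
  apply: eq_bigr => k kj; rewrite /dim_part -sum1_card; apply: eq_bigr => T _.
  by rewrite inE /ll_le ll_lt_ext_corner ?orbT.
rewrite (bigD1 j) ?ltnn //= [X in _ + X]big1 ?addr0 => [|k /andP[kj njk]].
  rewrite [RHS]big_mkcond; apply: eq_bigr => T _.
  by rewrite !inE /ll_le (inj_eq (@ext_syt_inj _ _ j)) ll_lt_ext.
have {kj njk} jk : (j < k)%N by rewrite ltn_neqAle eq_sym njk leqNgt.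
apply: big1 => T _; rewrite inE; case: ifP => // Tj.
have := ll_lt_ext_corner (tab i) T jk => jT.
have := @ll_le_anti _ _ (ext_syt T) (ext_syt (tab i)).
rewrite Tj /ll_le jT orbT => /(_ isT) e.
by rewrite e ll_lt_irr in jT.
Qed.

End BranchingIndex.

(** * Branching rule for Young's orthogonal form *)

Section BranchingRule.

Variables (R : realType) (m : nat) (lam : intpart m.+1).
Variables (p : 'S_m.+1 -> 'M[R]_(dim_part lam)).
Hypothesis p_young : is_young_rep p.
Implicit Types j : 'I_(ncorners lam).

Let pS (s : 'S_m) := p (lift_perm ord_max ord_max s).

(** An adjacent transposition fixing the largest entry only links tableaux with that entry in the
    same box; this passes to products, since an intermediate tableau cannot share its row with both
    ends. *)
Lemma young_rep_block (s : 'S_m) (a b : 'I_(dim_part lam)) :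
    row_of (val (tab a)) ord_max != row_of (val (tab b)) ord_max ->
  p (lift_perm ord_max ord_max s) a b = 0.
Proof.
have [p1 pM pA] := p_young; move: s a b.
apply: adjacent_ind => [|s t IHs IHt|k l ekl] a b rab.
- rewrite lift_perm1 p1 mxE; by case: (a =P b) rab => // ->; rewrite eqxx.
- rewrite -(lift_permM ord_max ord_max) pM mxE; apply: big1 => c _.
  case: (eqVneq (row_of (val (tab a)) ord_max) (row_of (val (tab c)) ord_max)).
    by move=> rac; rewrite IHs ?mulr0 // -rac.
  by move=> rac; rewrite IHt ?mul0r.
- rewrite lift_perm_tperm pA ?lift_max // mxE /=.
  case: (b =P a) rab => [->|_ rab]; first by rewrite eqxx.
  case: (val (tab b) =P _) rab => // ->.
  by rewrite /row_of /box ffunE tpermD ?eqxx // eq_sym neq_lift.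
Qed.

Lemma ext_swap (b : 'I_m.+1 * 'I_m.+1) (k l : 'I_m) (F : filling m) :
  swap (lift ord_max k) (lift ord_max l) (ext_filling b F) =
    ext_filling b (swap k l F).
Proof.
apply/ffunP => x; rewrite ffunE -lift_perm_tperm.
case: (unliftP ord_max x) => [i|] ->; last by rewrite lift_perm_id !ffunE unlift_none.
by rewrite lift_perm_lift !ffunE !liftK !ffunE.
Qed.

Lemma young_gen_ext j (k l : 'I_m) (a b : 'I_(dim_part (mu j))) :
  young_gen R lam (lift ord_max k) (lift ord_max l) (ext_index a) (ext_index b) =
    young_gen R (mu j) k l a b.
Proof.
rewrite !mxE (inj_eq (@ext_index_inj _ _ j)) !tab_ext_index /=.
by rewrite /cont_of !box_ext_lift ext_swap (inj_eq (@ext_filling_inj _ _)).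
Qed.

(** Restriction to a block is multiplicative since intermediate indices outside it contribute 0. On
    generators, contents and exchanges only involve the smaller entries. *)
Lemma young_rep_branching j : is_young_rep
  (fun s => mxsub (@ext_index _ _ j) (@ext_index _ _ j) (pS s)).
Proof.
have [p1 pM pA] := p_young; split.
- apply/matrixP => a b; rewrite /pS lift_perm1 p1 !mxE.
  by rewrite (inj_eq (@ext_index_inj _ _ j)).
- move=> s t; apply/matrixP => a b.
  rewrite /pS -(lift_permM ord_max ord_max) pM !mxE sum_index_branching.
  rewrite (bigD1 j) //= [X in _ + X]big1 ?addr0 => [|i nij].
    by apply: eq_bigr => c _; rewrite !mxE.
  apply: big1 => c _; rewrite young_rep_block ?mul0r // !tab_ext_index.
  by rewrite !row_ext_max eq_sym (inj_eq (@corner_row_inj _ _)).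
- move=> k l ekl; apply/matrixP => a b; rewrite mxE /pS lift_perm_tperm.
  by rewrite pA ?lift_max // young_gen_ext.
Qed.

End BranchingRule.

(** The block satisfies the relations that determine the form of [mu j] uniquely. *)
Lemma young_rep_ext_index (R : realType) (m : nat) (lam : intpart m.+1)
    (j : 'I_(ncorners lam)) (s : 'S_m) (i : 'I_(dim_part (mu j))) :
  young_rep R lam (lift_perm ord_max ord_max s) (ext_index i) (ext_index i) =
    young_rep R (mu j) s i i.
Proof.
rewrite (young_rep_unique (young_repP R (mu j))
  (young_rep_branching (young_repP R lam) j)).
by rewrite mxE.
Qed.

(** * Embedding of smaller symmetric groups, and the partial trace split into blocks *)

Lemma widen_permE r n (h : (r <= n)%N) (s : 'S_r) (i : 'I_r) (k : 'I_n) :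
  k = i :> nat -> widen_perm h s k = s i :> nat.
Proof. by move=> ki; rewrite permE /widen_perm_fun [val k]ki valK. Qed.

Lemma widen_perm_out r n (h : (r <= n)%N) (s : 'S_r) (k : 'I_n) :
  (r <= k)%N -> widen_perm h s k = k.
Proof. by move=> rk; rewrite permE /widen_perm_fun insubF // ltnNge rk. Qed.

(** Brings [sigma] to the shape [lift_perm ord_max ord_max] to which the branching rule applies. *)
Lemma widen_perm_succ r m (h : (r <= m)%N) (h' : (r <= m.+1)%N) (s : 'S_r) :
  widen_perm h' s = lift_perm ord_max ord_max (widen_perm h s).
Proof.
apply/permP => x; case: (unliftP ord_max x) => [k|] ->; last first.
  by rewrite lift_perm_id widen_perm_out.
rewrite lift_perm_lift; apply: val_inj; rewrite [RHS]lift_max.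
have [kr|rk] := ltnP k r; last first.
  by rewrite !widen_perm_out //; [exact: lift_max | rewrite lift_max].
rewrite (widen_permE h s (i := Ordinal kr)) // /=.
by apply: widen_permE; rewrite lift_max.
Qed.

Lemma PT_branching (R : realType) (m : nat) (lam : intpart m.+1) (u : R)
    (s : 'S_m) :
  PT lam u (lift_perm ord_max ord_max s) =
  \sum_(j < ncorners lam) \sum_(i < dim_part (mu j) |
      (\sum_(k < ncorners lam | (k < j)%N) dim_part (mu k) + i).+1%:R
        <= u * (dim_part lam)%:R)
    young_rep R (mu j) s i i / (dim_part lam)%:R.
Proof.
rewrite /PT big_mkcond sum_index_branching; apply: eq_bigr => j _.
rewrite [RHS]big_mkcond; apply: eq_bigr => i _.
by rewrite ext_index_val young_rep_ext_index.
Qed.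

(** * Jumps of [F_ct] and the bracket around u *)

Section TransitionDistribution.

Variables (R : realType) (m : nat) (lam : intpart m.+1).
Implicit Types j k : 'I_(ncorners lam).

Let s : R := Num.sqrt m.+1%:R.

Let s_gt0 : 0 < s. Proof. by rewrite sqrtr_gt0 ltr0Sn. Qed.

Lemma dim_ratio_ge0 j : 0 <= dim_ratio R j.
Proof. by rewrite divr_ge0 ?ler0n. Qed.

Lemma F_ct_le : {homo F_ct (R := R) lam : z w / z <= w}.
Proof.
move=> z w zw; rewrite /F_ct big_mkcond [leRHS]big_mkcond.
apply: ler_sum => k _; case: ifP => [yz|_]; last by case: ifP; rewrite ?dim_ratio_ge0.
by rewrite ifT //; apply: le_trans yz _; rewrite ler_wpM2r // ltW.
Qed.

Lemma y_cont_le_half j k :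
  ((y_cont k)%:~R <= (y_cont j)%:~R + 2^-1 :> R) = (k <= j)%N.
Proof.
rewrite leqNgt -y_cont_lt -leNgt; apply/idP/idP => [|kj].
  apply: contraLR; rewrite -!ltNge => jk.
  have : (y_cont j + 1)%:~R <= (y_cont k)%:~R :> R by rewrite ler_int lezD1.
  by rewrite intrD; lra.
have : (y_cont k)%:~R <= (y_cont j)%:~R :> R by rewrite ler_int.
lra.
Qed.

Lemma y_cont_lt_half j k :
  ((y_cont k)%:~R <= (y_cont j)%:~R - 2^-1 :> R) = (k < j)%N.
Proof.
rewrite -y_cont_lt; apply/idP/idP => [|kj].
  apply: contraLR; rewrite -ltNge -leNgt => jk.
  have : (y_cont j)%:~R <= (y_cont k)%:~R :> R by rewrite ler_int.
  lra.
have : (y_cont k + 1)%:~R <= (y_cont j)%:~R :> R by rewrite ler_int lezD1.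
by rewrite intrD; lra.
Qed.

Lemma F_ct_above j : F_ct lam (((y_cont j)%:~R + 2^-1) / s) =
  \sum_(k < ncorners lam | (k <= j)%N) dim_ratio R k.
Proof.
by apply: eq_bigl => k; rewrite divfK ?gt_eqF // y_cont_le_half.
Qed.

Lemma F_ct_below j : F_ct lam (((y_cont j)%:~R - 2^-1) / s) =
  \sum_(k < ncorners lam | (k < j)%N) dim_ratio R k.
Proof.
by apply: eq_bigl => k; rewrite divfK ?gt_eqF // y_cont_lt_half.
Qed.

Lemma sum_dim_ratio : dim_part lam != 0%N ->
  \sum_(k < ncorners lam) dim_ratio R k = 1.
Proof.
move=> D0; rewrite -mulr_suml -natr_sum -dim_branching divff //.
by rewrite pnatr_eq0.
Qed.

(* As the contents are integers, F_ct only jumps at the y_cont k / s, and it *)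
(* can be tested half a unit on either side of its jump at y_cont j / s. *)
Lemma F_ct_star_bracket (u : R) j : dim_part lam != 0%N -> 0 <= u < 1 ->
    F_ct_star lam u = (y_cont j)%:~R / s ->
  \sum_(k < ncorners lam | (k < j)%N) dim_ratio R k <= u <
    \sum_(k < ncorners lam | (k <= j)%N) dim_ratio R k.
Proof.
rewrite /F_ct_star; set A := [set z | _]%classic => D0 /andP[u0 u1] eA.
have nc : (0 < ncorners lam)%N by apply: leq_trans (ltn_ord j).
have ncV : ((ncorners lam).-1 < ncorners lam)%N by rewrite prednK.
(* Beyond the largest content [F_ct] equals 1 > u. *)
have Aub : has_ubound A.
  exists (((y_cont (Ordinal ncV))%:~R + 2^-1) / s) => z /= Az.
  rewrite leNgt; apply/negP => /ltW/F_ct_le; apply/negP; rewrite -ltNge.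
  apply: le_lt_trans Az _; apply: (lt_le_trans u1); rewrite F_ct_above.
  rewrite (eq_bigl xpredT) ?sum_dim_ratio // => k /=.
  by have := ltn_ord k; lia.
(* Below the smallest content [F_ct] equals 0 <= u. *)
have Asup : has_sup A.
  split=> //; exists (((y_cont (Ordinal nc))%:~R - 2^-1) / s).
  by rewrite /A /= F_ct_below big_pred0.
apply/andP; split.
  have : ((y_cont j)%:~R - 2^-1) / s < sup A.
    by rewrite eA ltr_pM2r ?invr_gt0 //; lra.
  move=> /(sup_gt Asup.1)[z Az /ltW/F_ct_le].
  by rewrite F_ct_below => /le_trans; apply.
rewrite -F_ct_above ltNge; apply/negP => /(ub_le_sup Aub).
by rewrite eA ler_pM2r ?invr_gt0 //; lra.
Qed.

End TransitionDistribution.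

(** * Cutting the trace inside one block *)

Section PartialTrace.

Variables (R : realType) (m : nat) (lam : intpart m.+1).
Implicit Types j k : 'I_(ncorners lam).

Lemma ratio_chi_hat j (s : 'S_m) :
  dim_ratio R j * chi_hat R (mu j) s =
    \sum_(i < dim_part (mu j)) young_rep R (mu j) s i i / (dim_part lam)%:R.
Proof.
rewrite /chi_hat /chi /mxtrace /dim_ratio -mulr_suml.
have [d0|d0] := eqVneq (dim_part (mu j)) 0%N.
  rewrite big1 ?mul0r ?mulr0 // => i _; exfalso.
  by have := ltn_ord i; rewrite [X in (_ < X)%N]d0.
by rewrite mulrC mulrA divfK // pnatr_eq0.
Qed.

Lemma ratio_PT j (v : R) (s : 'S_m) :
  dim_ratio R j * PT (mu j) v s =
    \sum_(i < dim_part (mu j) | i.+1%:R <= v * (dim_part (mu j))%:R)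
      young_rep R (mu j) s i i / (dim_part lam)%:R.
Proof.
rewrite /PT mulr_sumr; apply: eq_bigr => i _; rewrite mulrC mulrA divfK //.
by rewrite pnatr_eq0 -lt0n; apply: leq_ltn_trans (ltn_ord i).
Qed.

Lemma sum_dim_lt j k : (j < k)%N ->
  (\sum_(i < ncorners lam | (i <= j)%N) dim_part (mu i) <=
    \sum_(i < ncorners lam | (i < k)%N) dim_part (mu i))%N.
Proof.
move=> jk; rewrite big_mkcond [leqRHS]big_mkcond.
by apply: leq_sum => i _; case: ifP => // /leq_ltn_trans->.
Qed.

Lemma sum_ord_le (V : nmodType) (G : 'I_(ncorners lam) -> V) j :
  \sum_(i < ncorners lam | (i <= j)%N) G i =
    \sum_(i < ncorners lam | (i < j)%N) G i + G j.
Proof.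
rewrite (bigD1 j) //= addrC; congr (_ + _); apply: eq_bigl => i.
by rewrite ltn_neqAle andbC.
Qed.

(** Multiplied by dim lam, the bracket places the cut u dim lam at or after the end of every block
    before j, strictly before the end of block j, and so before the first index of any later
    block. *)
Lemma PT_bracket (u : R) j (s : 'S_m) : dim_part lam != 0%N ->
    \sum_(k < ncorners lam | (k < j)%N) dim_ratio R k <= u <
      \sum_(k < ncorners lam | (k <= j)%N) dim_ratio R k ->
  u_bar u j < 1 /\
  PT lam u (lift_perm ord_max ord_max s) =
    \sum_(k < ncorners lam | (k < j)%N) dim_ratio R k * chi_hat R (mu k) s
    + dim_ratio R j * PT (mu j) (u_bar u j) s.
Proof.
move=> D0; rewrite sum_ord_le /u_bar; set D : R := (dim_part lam)%:R.
pose N k := (\sum_(i < ncorners lam | (i < k)%N) dim_part (mu i))%N.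
have Dgt0 : 0 < D by rewrite ltr0n lt0n.
have -> : \sum_(k < ncorners lam | (k < j)%N) dim_ratio R k = (N j)%:R / D.
  by rewrite -mulr_suml natr_sum.
rewrite {2}/dim_ratio -/D -mulrDl ler_pdivrMr // ltr_pdivlMr // => /andP[Nu uN].
set d : R := (dim_part (mu j))%:R in uN *.
(* The strict upper half of the bracket forces dim (mu j) > 0, so that [u_bar] is a genuine
   quotient. *)
have d0 : 0 < d by lra.
have ub : D / d * (u - (N j)%:R / D) = (u * D - (N j)%:R) / d.
  by field; rewrite !gt_eqF.
rewrite ub; split; first by rewrite ltr_pdivrMr //; lra.
rewrite PT_branching (bigID (fun k : 'I_(ncorners lam) => k < j)%N) /=.
congr (_ + _).
  apply: eq_bigr => k kj; rewrite ratio_chi_hat; apply: eq_bigl => i.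
  apply: le_trans Nu; rewrite ler_nat; apply: leq_trans (sum_dim_lt kj).
  by rewrite sum_ord_le -addnS leq_add2l.
rewrite (bigD1 j) ?ltnn //= [X in _ + X]big1 ?addr0 => [|k /andP[kj njk]].
  rewrite ratio_PT; apply: eq_bigl => i.
  by rewrite divfK ?gt_eqF // lerBrDl -natrD addnS.
apply: big_pred0 => i; apply/negbTE; rewrite -ltNge.
have {kj njk} /sum_dim_lt jk : (j < k)%N by rewrite ltn_neqAle eq_sym njk leqNgt.
apply: (lt_le_trans uN); rewrite -natrD ler_nat.
by apply: leq_trans (leq_trans jk _); rewrite ?sum_ord_le // -addnS leq_addr.
Qed.

End PartialTrace.

Theorem proposition2p8 (R : realType) (n r : nat) (hn : (0 < n)%N)
    (hr : (r <= n.-1)%N) (u : R) (hu : 0 <= u < 1) (lam : intpart n)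
    (sigma : 'S_r) (jbar : 'I_(ncorners lam))
    (hjbar : F_ct_star lam u = (y_cont jbar)%:~R / Num.sqrt n%:R) :
  u_bar u jbar < 1 /\
  PT lam u (widen_perm (leq_trans hr (leq_pred n)) sigma) =
    \sum_(j < ncorners lam | (j < jbar)%N)
       (dim_part (mu j))%:R / (dim_part lam)%:R * chi_hat R (mu j) (widen_perm hr sigma)
    + (dim_part (mu jbar))%:R / (dim_part lam)%:R
        * PT (mu jbar) (u_bar u jbar) (widen_perm hr sigma).
Proof.
case: n hn hr lam jbar hjbar => // m _ hr lam j hj.
rewrite (widen_perm_succ hr).
have [D0|D0] := eqVneq (dim_part lam) 0%N; last first.
  exact/PT_bracket/F_ct_star_bracket.
(* D0 does not occur, but then both sides vanish since x / 0 = 0. *)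
split; first by rewrite /u_bar D0 !mul0r.
rewrite PT_branching D0 mulr0n invr0 !mulr0 mul0r addr0 !big1 // => k _.
  by rewrite mulr0 mul0r.
by rewrite big1 // => i _; rewrite mulr0.
Qed.
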